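(* Let $d\ge3$. A point $(C,p)$ of $M$ corresponds to a singular sheaf if and only if $p$ is a singular point of $C$; i.e. the subvariety $M'\subset M$ of points corresponding to singular sheaves coincides with the universal singular locus $\{(C,p)\in M\mid p\in\mathrm{Sing}(C)\}$.
   Context: Let $\Bbbk$ be an algebraically closed field of characteristic zero; varieties are separated schemes of finite type over $\Bbbk$, and points are closed points. $\mathbb P_N=\mathbb P(S^dV^* )$ is the space of plane curves of degree $d$ in $\mathbb P_2=\mathbb P V$, $\dim V=3$ (a curve $C$ is identified with its equation $f$ up to a non-zero constant, written $\langle f\rangle$; curves may be reducible or non-reduced). The universal plane curve is $M=\{(C,p)\mid p\in C\}\subset\mathbb P_N\times\mathbb P_2$. A point $p\in C$ is singular, $p\in\mathrm{Sing}(C)$, if all partial derivatives of the equation $f$ of $C$ vanish at $p$. $X$ is the space of morphisms $2\mathcal O_{\mathbb P_2}(-d+1)\xrightarrow{A}\mathcal O_{\mathbb P_2}(-d+2)\oplus\mathcal O_{\mathbb P_2}$, $A=\begin{pmatrix}z_1&q_1\\ z_2&q_2\end{pmatrix}$ (acting on row vectors from the right; $z_i$ linear forms, $q_i$ forms of degree $d-1$), with $z_1,z_2$ linearly independent and $\det A\ne0$. The surjective morphism $\nu:X\to M$ sends $A$ to $(\langle z_1q_2-z_2q_1\rangle,z_1\wedge z_2)$, where $z_1\wedge z_2$ is the common zero of $z_1,z_2$. The point $(C,p)\in M$ corresponds to the isomorphism class of the sheaf $\mathcal F=\mathrm{coker}\,A$ for any $A$ with $\nu(A)=(C,p)$ (this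 class does not depend on the choice of $A$). A sheaf $\mathcal F=\mathrm{coker}\,A$ is called singular if it is not locally free on its support, the support being the curve defined by $\det A$. *)

(* Defs.v *)
From HB Require Import structures.
From mathcomp Require Import all_boot all_order all_algebra.
From mathcomp Require Import mpoly.

Set Implicit Arguments.
Unset Strict Implicit.
Unset Printing Implicit Defensive.

Import GRing.Theory.
Local Open Scope ring_scope.

(* Points of P_2 are represented by non-zero vectors p of k^3, curves by       *)
(* non-zero forms f in k[x_0, x_1, x_2]; every predicate below depends only    *)
(* on the class of p, resp. f, up to non-zero scalars.                         *)

Notation form k := {mpoly k[3]}.
Notation ratfun k := {fraction {mpoly k[3]}}.

Section ProjectivePlane.
Variable k : fieldType.
Implicit Types (f g : form k) (p x y : 'rV[k]_3).

Definition val_at f p : k := f.@[p 0].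

Definition same_class f g : Prop := exists2 c : k, c != 0 & g = c *: f.

(* The stalk O(n)_x inside the field of rational functions of the affine cone: *)
(* fractions a / b of forms with deg a - deg b = n and b(x) != 0.              *)
Definition line_stalk (n : int) x (s : ratfun k) : Prop :=
  exists (i j : nat) (a b : form k),
    [/\ a \is i.-homog, b \is j.-homog, val_at b x != 0,
        i%:Z = j%:Z + n & s = tofrac a / tofrac b].

(* The stalk at x of the direct sum of the line bundles O(b j).                *)
Definition bundle_stalk n (b : 'I_n -> int) x (t : 'rV[ratfun k]_n) : Prop :=
  forall j, line_stalk (b j) x (t 0 j).

(* The stalk at x of the ideal sheaf f O(-d) of the curve of degree d defined  *)
(* by f, so that O_{C,x} = O_x / curve_ideal d f x.                            *)
Definition curve_ideal (d : nat) f x (c : ratfun k) : Prop :=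
  exists2 s, line_stalk (- d%:Z) x s & c = s * tofrac f.

(* The image of A_x : (+)_i O(a i)_x -> (+)_j O(b j)_x, t |-> t A;  the stalk  *)
(* at x of coker A is bundle_stalk b x modulo image_stalk a A x.               *)
Definition image_stalk m n (a : 'I_m -> int) (A : 'M[form k]_(m, n)) x
    (t : 'rV[ratfun k]_n) : Prop :=
  exists2 s, bundle_stalk a x s & t = s *m map_mx (@tofrac _) A.

(* On the stalks at y, the morphism O_C^r -> coker A given by the rows of e    *)
(* (sections of (+)_j O(b j) near y) is an isomorphism: it is surjective, and  *)
(* it is well defined and injective.                                           *)
Definition stalk_basis d f m n (a : 'I_m -> int) (b : 'I_n -> int)
    (A : 'M[form k]_(m, n)) r (e : 'M[ratfun k]_(r, n)) y : Prop :=
  (forall t, bundle_stalk b y t ->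
     exists2 c : 'rV_r, bundle_stalk (fun=> 0) y c
                      & image_stalk a A y (t - c *m e)) /\
  (forall c : 'rV_r, bundle_stalk (fun=> 0) y c ->
     image_stalk a A y (c *m e) <-> forall i, curve_ideal d f y (c 0 i)).

(* coker A is a locally free sheaf of O_C-modules, C the curve f = 0 of degree *)
(* d: each point x of C has an open neighbourhood U on which O_C^r and coker A *)
(* are isomorphic.  As the sets {g != 0} form a basis of the topology and      *)
(* sections of coker A lift locally, U is taken of this form and small enough  *)
(* for the r sections defining the isomorphism to lift to (+)_j O(b j).        *)
Definition coker_locally_free d f m n (a : 'I_m -> int) (b : 'I_n -> int)
    (A : 'M[form k]_(m, n)) : Prop :=
  forall x, x != 0 -> val_at f x = 0 ->
  exists (r : nat) (e : 'M[ratfun k]_(r, n)) (l : nat) (g : form k),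
    [/\ g \is l.-homog, val_at g x != 0,
        forall y, y != 0 -> val_at g y != 0 ->
          forall i, bundle_stalk b y (row i e)
      & forall y, y != 0 -> val_at g y != 0 -> val_at f y = 0 ->
          stalk_basis d f a b A e y].

Section UniversalCurve.
Variable d : nat.

(* A = (z_1 q_1; z_2 q_2) : 2 O(-d+1) -> O(-d+2) (+) O *)
Definition src_twist (i : 'I_2) : int := 1 - d%:Z.
Definition tgt_twist (j : 'I_2) : int := if j == 0 then 2 - d%:Z else 0.

Definition in_X (A : 'M[form k]_2) : Prop :=
  [/\ forall i, A i 0 \is 1.-homog,
      forall i, A i 1 \is (d.-1).-homog,
      forall u v : k, u *: A 0 0 + v *: A 1 0 = 0 -> u = 0 /\ v = 0
    & \det A != 0].

(* (<f>, <p>) belongs to the universal curve M. *)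
Definition in_M f p : Prop :=
  [/\ f != 0, f \is d.-homog, p != 0 & val_at f p = 0].

(* nu(A) = (<f>, <p>), for p != 0; note det A = z_1 q_2 - q_1 z_2. *)
Definition nu_is (A : 'M[form k]_2) f p : Prop :=
  same_class (\det A) f /\ forall i, val_at (A i 0) p = 0.

Definition singular_coker (A : 'M[form k]_2) : Prop :=
  ~ coker_locally_free d (\det A) src_twist tgt_twist A.

(* (<f>, <p>) belongs to M', i.e. is nu(A) for some A with coker A singular. *)
Definition in_M' f p : Prop :=
  in_M f p /\ exists A, [/\ in_X A, nu_is A f p & singular_coker A].

Definition is_sing f p : Prop :=
  val_at f p = 0 /\ forall i : 'I_3, val_at (mderiv i f) p = 0.

Definition in_universal_sing f p : Prop := in_M f p /\ is_sing f p.

End UniversalCurve.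
End ProjectivePlane.

(* Main.v *)
Require Import Defs.
From HB Require Import structures.
From mathcomp Require Import all_boot all_order all_algebra.
From mathcomp Require Import mpoly.
From mathcomp Require Import zify ring.

Set Implicit Arguments.
Unset Strict Implicit.
Unset Printing Implicit Defensive.

Import GRing.Theory.
Local Open Scope ring_scope.

(** The gradient of det A at p is q_2(p) grad z_1 - q_1(p) grad z_2, so p is
    singular on C iff all four entries of A vanish at p.  If an entry of A is
    a unit at x, eliminating it presents coker A near x as O_C, generated by
    one section.  If A vanishes at p, suppose that r sections e give
    O_C^r = coker A near p.  In the trivialised local ring at p write
    1 = C e + S A; then A C e = (1 - A S) A is zero in coker A, hence
    A C = (det A) T, so that C = adj(A) T, and 1 = adj(A) T e + S A vanishes
    modulo the maximal ideal: a contradiction. *)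

(** * Two-element index sets and the two-by-two determinant *)

Lemma sum2_neq (V : nmodType) (F : 'I_2 -> V) (i0 i1 : 'I_2) :
  i0 != i1 -> \sum_i F i = F i0 + F i1.
Proof.
rewrite !big_ord_recl big_ord0 addr0.
case: i0 => [[|[|?]] ?] //; case: i1 => [[|[|?]] ?] // _; last rewrite addrC.
  by congr (F _ + F _); apply: val_inj.
by congr (F _ + F _); apply: val_inj.
Qed.

Lemma det_mx22 (R : comPzRingType) (A : 'M[R]_2) :
  \det A = A 0 0 * A 1 1 - A 0 1 * A 1 0.
Proof.
rewrite (expand_det_row _ 0) (@sum2_neq _ _ 0 1) // /cofactor !det_mx11 !mxE.
rewrite /= expr0 expr1 mul1r mulN1r mulrN.
by congr (_ * A _ _ - _ * A _ _); apply: val_inj.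
Qed.

(** * Forms, twisted stalks and the local ring of the cone at a point *)

Section Forms.
Variable k : fieldType.
Implicit Types (f g a b : {mpoly k[3]}) (p x y : 'rV[k]_3)
  (s t : {fraction {mpoly k[3]}}).

Lemma val_atM f g x : val_at (f * g) x = val_at f x * val_at g x.
Proof. exact: mevalM. Qed.

Lemma val_atD f g x : val_at (f + g) x = val_at f x + val_at g x.
Proof. exact: mevalD. Qed.

Lemma val_atXn f n x : val_at (f ^+ n) x = val_at f x ^+ n.
Proof. exact: rmorphXn. Qed.

Lemma val_at_neq0 f x : val_at f x != 0 -> tofrac f != 0.
Proof. by rewrite tofrac_eq0; apply: contra_neq => ->; rewrite /val_at meval0. Qed.

Lemma val_atZ_homog f n x c :
  f \is n.-homog -> val_at f (c *: x) = c ^+ n * val_at f x.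
Proof.
move=> fn; rewrite /val_at !mevalE mulr_sumr; apply: eq_big_seq => m mf.
rewrite mulrCA; congr (_ * _).
have <- : mdeg m = n := dhomog_mf fn mf.
rewrite mdegE -prodrXr -big_split /=.
by apply: eq_bigr => i _; rewrite mxE exprMn.
Qed.

Lemma linear_formE f : f \is 1.-homog -> f = \sum_i f@_U_(i) *: 'X_i.
Proof.
move=> f1; apply/mpolyP => m; rewrite raddf_sum /=.
have [/mdeg1P[i /eqP ->]|] := boolP (mdeg m == 1%N); last first.
  move=> m1; rewrite (dhomog_nemf_coeff f1 m1) big1 // => i _.
  rewrite mcoeffZ mcoeffX; case: eqP => [e|_]; last by rewrite mulr0.
  by rewrite -e mdeg1 in m1.
rewrite (bigD1 i) //= big1 => [|j ji]; rewrite mcoeffZ mcoeffX.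
  by rewrite eqxx mulr1 addr0.
by rewrite eq_mnm1 (negPf ji) mulr0.
Qed.

Lemma mderiv_linear f i : f \is 1.-homog -> f^`M(i) = (f@_U_(i))%:MP.
Proof.
move=> /linear_formE {1}->; rewrite raddf_sum /= (bigD1 i) //= big1 => [|j ji].
  rewrite mderivZ mderivX mnm1E eqxx scale1r addr0.
  have -> : (U_(i) - U_(i) = 0)%MM by rewrite -{1}[U_(i)%MM]add0m addmK.
  by rewrite mpolyX0 alg_mpolyC.
by rewrite mderivZ mderivX mnm1E (negPf ji) scale0r scaler0.
Qed.

Lemma line_stalkP n x s i j a b :
  a \is i.-homog -> b \is j.-homog -> val_at b x != 0 ->
  i%:Z = j%:Z + n -> s = tofrac a / tofrac b -> line_stalk n x s.
Proof. by move=> *; exists i, j, a, b; split. Qed.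

Lemma line_stalk_cast m n x s : line_stalk m x s -> m = n -> line_stalk n x s.
Proof. by move=> ? <-. Qed.

Lemma line_stalk0 n x : x != 0 -> line_stalk n x 0.
Proof.
(* The zero numerator may be given any degree; a denominator of degree [|n|] makes the required
   degree [|n| + n] a natural number. *)
case/rV0Pn=> c xc0; exists `|(`|n|%N%:Z + n)%R|%N, `|n|%N, 0, ('X_c ^+ `|n|%N).
split.
- exact: dhomog0.
- rewrite -[X in X.-homog]mul1n; apply: dhomogMn.
  by rewrite dhomogX /= mdeg1.
- by rewrite val_atXn expf_neq0 // /val_at mevalXU.
- lia.
- by rewrite tofrac0 mul0r.
Qed.

Lemma line_stalkN n x s : line_stalk n x s -> line_stalk n x (- s).
Proof.
case=> i [j [a [b [ai bj bx e ->]]]].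
apply: (line_stalkP (_ : - a \is i.-homog) bj bx e); first by rewrite rpredN.
by rewrite tofracN mulNr.
Qed.

Lemma line_stalkD n x s t :
  line_stalk n x s -> line_stalk n x t -> line_stalk n x (s + t).
Proof.
case=> i [j [a [b [ai bj bx e ->]]]] [i' [j' [a' [b' [ai' bj' bx' e' ->]]]]].
apply: (@line_stalkP _ _ _ (i + j')%N (j + j')%N (a * b' + a' * b) (b * b')).
- apply: rpredD; first exact: dhomogM.
  have -> : (i + j' = i' + j)%N by lia.
  exact: dhomogM.
- exact: dhomogM.
- by rewrite val_atM mulf_neq0.
- lia.
- by rewrite tofracD !tofracM addf_div // (@val_at_neq0 _ x).
Qed.

Lemma line_stalkM m n x s t :
  line_stalk m x s -> line_stalk n x t -> line_stalk (m + n) x (s * t).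
Proof.
case=> i [j [a [b [ai bj bx e ->]]]] [i' [j' [a' [b' [ai' bj' bx' e' ->]]]]].
apply: (@line_stalkP _ _ _ (i + i')%N (j + j')%N (a * a') (b * b')).
- exact: dhomogM.
- exact: dhomogM.
- by rewrite val_atM mulf_neq0.
- lia.
- by rewrite !tofracM mulf_div.
Qed.

Lemma line_stalk_form n x a : a \is n.-homog -> line_stalk n%:Z x (tofrac a).
Proof.
move=> an; apply: (line_stalkP an (dhomog1 _ _)).
- by rewrite /val_at meval1 oner_eq0.
- lia.
- by rewrite tofrac1 divr1.
Qed.

Lemma line_stalkV n x b : b \is n.-homog -> val_at b x != 0 ->
  line_stalk (- n%:Z) x (tofrac b)^-1.
Proof.
move=> bn bx; apply: (line_stalkP (dhomog1 _ _) bn bx); first lia.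
by rewrite tofrac1 div1r.
Qed.


(* The maximal ideal of the (ungraded) local ring of the affine cone at x. *)
Definition local_max x s := exists a b : {mpoly k[3]},
  [/\ val_at b x != 0, val_at a x = 0 & s = tofrac a / tofrac b].

Lemma local_max0 x : local_max x 0.
Proof.
exists 0, 1; split; first by rewrite /val_at meval1 oner_eq0.
  exact: meval0.
by rewrite tofrac0 mul0r.
Qed.

Lemma local_maxD x s t : local_max x s -> local_max x t -> local_max x (s + t).
Proof.
case=> a [b [bx ax ->]] [a' [b' [bx' ax' ->]]].
exists (a * b' + a' * b), (b * b'); split.
- by rewrite val_atM mulf_neq0.
- by rewrite val_atD !val_atM ax ax' !mul0r addr0.
- by rewrite tofracD !tofracM addf_div // (@val_at_neq0 _ x).
Qed.

Lemma local_max_sum x (I : finType) (F : I -> {fraction {mpoly k[3]}}) :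
  (forall i, local_max x (F i)) -> local_max x (\sum_i F i).
Proof.
by move=> mF; elim/big_rec: _ => [|i s _]; [exact: local_max0|exact: local_maxD].
Qed.

(** Elements of every twisted stalk are regular at [x], and [local_max] forgets the grading, so one
    ideal absorbs all twists. *)
Lemma local_maxMl x n s t : line_stalk n x s -> local_max x t -> local_max x (s * t).
Proof.
case=> i [j [a [b [_ _ bx _ ->]]]] [a' [b' [bx' ax' ->]]].
exists (a * a'), (b * b'); split.
- by rewrite val_atM mulf_neq0.
- by rewrite val_atM ax' mulr0.
- by rewrite !tofracM mulf_div.
Qed.

Lemma local_max_form x a : val_at a x = 0 -> local_max x (tofrac a).
Proof.
move=> ax; exists a, 1; split; rewrite ?tofrac1 ?divr1 //.
by rewrite /val_at meval1 oner_eq0.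
Qed.

Lemma local_max1 x : ~ local_max x 1.
Proof.
case=> a [b [bx ax]] e; move: (bx); suff -> : b = a by rewrite ax eqxx.
apply/eqP; rewrite -tofrac_eq; apply/eqP.
by rewrite -[LHS]mul1r e divfK // (@val_at_neq0 _ x).
Qed.

Lemma form_coord_neq0 x : x != 0 ->
  exists2 h : {mpoly k[3]}, h \is 1.-homog & val_at h x != 0.
Proof.
case/rV0Pn=> c xc; exists 'X_c; first by rewrite dhomogX /= mdeg1.
by rewrite /val_at mevalXU.
Qed.

End Forms.

(** * Elimination with an invertible pivot *)

Lemma ord2_neqW (i0 i1 : 'I_2) (P : 'I_2 -> Prop) :
  i0 != i1 -> P i0 -> P i1 -> forall i, P i.
Proof.
move=> i01 P0 P1 i; have [-> //|i_0] := eqVneq i i0.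
suff -> : i = i1 by [].
apply: val_inj; move: i01 i_0; rewrite -!val_eqE /=.
by have := (ltn_ord i0, ltn_ord i1, ltn_ord i) => -[[]]; lia.
Qed.

(** For injectivity: if a combination of the rows [(a, b)] and [(c, e)] cancels the first column and
    has coefficient [s] on the second row, its other coordinate is [s / a] times the determinant.
    The factor [h] trivialises a twist. *)
Lemma eliminate_pivot (F : fieldType) (a b c e s h : F) : a != 0 ->
  (- (s * c) / a * b + s * e) * h = s * h / a * (a * e - b * c).
Proof. by move=> a0; field. Qed.

(** The converse: a multiple [w] of the determinant is reached by explicit row coefficients; [s]
    stands for the sign attached to the position of the pivot. *)
Lemma solve_pivot (F : fieldType) (a b c e s h w : F) : a != 0 -> h != 0 ->
  w * (s * (a * e - b * c)) / h
  = - (s * (w * a / h) * c / a) * b + s * (w * a / h) * e.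
Proof. by move=> a0 h0; field; rewrite a0 h0. Qed.

(** * The cokernel of [A] near a point *)

Section Cokernel.
Variables (k : fieldType) (d : nat) (A : 'M[{mpoly k[3]}]_2).
Hypotheses (d_gt1 : (1 < d)%N) (AX : in_X d A).
Implicit Types (x y : 'rV[k]_3).

Lemma in_X_entry i j :
  exists2 n : nat, A i j \is n.-homog & n%:Z = tgt_twist d j - src_twist d i.
Proof.
case: AX => A0 A1 _ _; rewrite /tgt_twist /src_twist.
have [->|j0] := eqVneq j 0; first by exists 1%N; [exact: A0|lia].
have -> : j = 1 by case: j j0 => [[|[|?]] ?] // ?; apply: val_inj.
by exists d.-1; [exact: A1|lia].
Qed.

Lemma entry_stalk y i j :
  line_stalk (tgt_twist d j - src_twist d i) y (tofrac (A i j)).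
Proof. by have [n An <-] := in_X_entry i j; apply: line_stalk_form. Qed.

Lemma entry_stalkV y i j : val_at (A i j) y != 0 ->
  line_stalk (src_twist d i - tgt_twist d j) y (tofrac (A i j))^-1.
Proof.
have [n An e] := in_X_entry i j => Ay.
by apply: line_stalk_cast (line_stalkV An Ay) _; rewrite e opprB.
Qed.

(** This is the degree of [\det A], namely [(2 - d) + 0 - 2 (1 - d)]; it accounts for the twist by
    [- d] in [curve_ideal]. *)
Lemma twist_sum i i' j j' : i != i' -> j != j' ->
  tgt_twist d j + tgt_twist d j' - src_twist d i - src_twist d i' = d%:Z.
Proof.
rewrite /tgt_twist /src_twist.
by case: j j' => [[|[|?]] ?] [[|[|?]] ?] //= _ _; lia.
Qed.

(** Lets any entry serve as pivot: moving it to the upper left corner costs a sign exactly when it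
    lies off the diagonal. *)
Lemma det_entries i0 i1 j0 j1 : i0 != i1 -> j0 != j1 ->
  A i0 j0 * A i1 j1 - A i0 j1 * A i1 j0 = (-1) ^+ (i0 != j0) * \det A.
Proof.
have ord2 (i : 'I_2) : (i = 0) \/ (i = 1).
  by case: i => [[|[|?]] ?] //; [left|right]; apply: val_inj.
rewrite det_mx22; case: (ord2 i0) (ord2 i1) (ord2 j0) (ord2 j1).
by move=> -> [] -> // [] -> [] -> //= _ _; ring.
by move=> -> [] -> // [] -> [] -> //= _ _; ring.
Qed.

Lemma mul_entries (s : 'rV_2) i0 i1 j : i0 != i1 ->
  (s *m map_mx (@tofrac _) A) 0 j
  = s 0 i0 * tofrac (A i0 j) + s 0 i1 * tofrac (A i1 j).
Proof. by move=> i01; rewrite mxE (sum2_neq _ i01) !mxE. Qed.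

(** Since [A i0 j0] is a unit at [y], row [i0] expresses generator [j0] of the cokernel through
    generator [j1]. The relation left by the other row is the determinant up to a unit, so generator
    [j1], rescaled by [h], is a basis over [O_C]. *)
Lemma stalk_basis_of_entry y i0 i1 j0 j1 (h : {mpoly k[3]}) m :
  i0 != i1 -> j0 != j1 -> y != 0 -> val_at (A i0 j0) y != 0 ->
  h \is m.-homog -> val_at h y != 0 -> m%:Z = - tgt_twist d j1 ->
  stalk_basis d (\det A) (src_twist d) (tgt_twist d) A
    ((tofrac h)^-1 *: delta_mx (0 : 'I_1) j1) y.
Proof.
move=> i01 j01 y0 Ay hm hy me.
have a_nz : tofrac (A i0 j0) != 0 by apply: val_at_neq0 Ay.
have h_nz : tofrac h != 0 by apply: val_at_neq0 hy.
have D_eq : tofrac (A i0 j0) * tofrac (A i1 j1) - tofrac (A i0 j1) * tofrac (A i1 j0)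
    = (-1) ^+ (i0 != j0) * tofrac (\det A).
  by rewrite -!tofracM -tofracB det_entries // tofracM rmorphXn /= tofracN tofrac1.
have signS n s (b : bool) : line_stalk n y s -> line_stalk n y ((-1) ^+ b * s).
  by case: b => sS; rewrite ?expr0 ?mul1r // expr1 mulN1r; apply: line_stalkN.
have aS i j := entry_stalk y i j.
have aV := entry_stalkV Ay.
have hS : line_stalk (- tgt_twist d j1) y (tofrac h).
  by rewrite -me; apply: line_stalk_form.
have hV : line_stalk (tgt_twist d j1) y (tofrac h)^-1.
  by apply: line_stalk_cast (line_stalkV hm hy) _; rewrite me opprK.
have eE (c : 'rV_1) j : (c *m ((tofrac h)^-1 *: delta_mx (0 : 'I_1) j1)) 0 j
    = c 0 0 / tofrac h * (j == j1)%:R.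
  by rewrite mxE big_ord1 !mxE eqxx mulrA.
have tw := twist_sum i01 j01.
split=> [t tS|c cS].
  (* Surjectivity: subtracting a multiple of row [i0] clears coordinate [j0] of [t]. *)
  have xS : line_stalk (src_twist d i0) y (t 0 j0 / tofrac (A i0 j0)).
    by apply: line_stalk_cast (line_stalkM (tS j0) aV) _; ring.
  exists (((t 0 j1 - t 0 j0 / tofrac (A i0 j0) * tofrac (A i0 j1)) * tofrac h)%:M).
    move=> i; rewrite [i]ord1 mxE eqxx mulr1n.
    apply: line_stalk_cast (line_stalkM (line_stalkD (tS j1) (line_stalkN _)) hS) _.
      by apply: line_stalk_cast (line_stalkM xS (aS i0 j1)) _; ring.
    by ring.
  exists ((t 0 j0 / tofrac (A i0 j0)) *: delta_mx 0 i0).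
    apply: (ord2_neqW i01); rewrite !mxE !eqxx ?mulr1 //=.
    by rewrite [i1 == i0]eq_sym (negPf i01) mulr0; apply: line_stalk0.
  apply/rowP; apply: (ord2_neqW j01); rewrite (mul_entries _ _ i01) mxE [X in _ + X]mxE.
    rewrite eE (negPf j01) !mxE !eqxx [i1 == i0]eq_sym (negPf i01) /=.
    by rewrite !mulr0 subr0 mulr1 mul0r addr0 (divfK a_nz).
  rewrite eE !mxE !eqxx [i1 == i0]eq_sym (negPf i01) /=.
  by rewrite !mulr1 mulr0 mul0r addr0 mulr1n (mulfK h_nz) opprB addrC subrK.
(* Coordinate [j0] of [es] determines [s 0 i0] from [s 0 i1]; coordinate [j1] then shows [c] to be a
   multiple of the determinant. *)
split=> [[s sS es] i|cI].
  rewrite [i]ord1.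
  exists ((-1) ^+ (i0 != j0) * (s 0 i1 * tofrac h / tofrac (A i0 j0))).
    apply: signS; apply: line_stalk_cast (line_stalkM (line_stalkM (sS i1) hS) aV) _.
    by rewrite -tw; ring.
  have es0 := congr1 (fun v : 'rV__ => v 0 j0) es.
  have es1 := congr1 (fun v : 'rV__ => v 0 j1) es.
  rewrite /= eE (mul_entries _ _ i01) (negPf j01) mulr0 in es0.
  rewrite /= eE (mul_entries _ _ i01) eqxx mulr1 in es1.
  rewrite mulrAC -D_eq.
  have -> : c 0 0 = (s 0 i0 * tofrac (A i0 j1) + s 0 i1 * tofrac (A i1 j1)) * tofrac h.
    by rewrite -es1 (divfK h_nz).
  have -> : s 0 i0 = - (s 0 i1 * tofrac (A i1 j0)) / tofrac (A i0 j0).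
    by apply: (canRL (mulfK a_nz)); apply/esym/addr0_eq; rewrite addrC.
  by rewrite [RHS]mulrC; apply: eliminate_pivot a_nz.
have [w wS cE] := cI 0.
have ws : line_stalk (src_twist d i1) y
    ((-1) ^+ (i0 != j0) * (w * tofrac (A i0 j0) / tofrac h)).
  apply: signS; apply: line_stalk_cast (line_stalkM (line_stalkM wS (aS i0 j0)) hV) _.
  by rewrite -tw; ring.
(* [v] is the coefficient of row [i1]; cancelling column [j0] forces that of row [i0]. *)
set v := _ * _ in ws.
exists (v *: delta_mx 0 i1 - (v * tofrac (A i1 j0) / tofrac (A i0 j0)) *: delta_mx 0 i0).
  apply: (ord2_neqW i01); rewrite !mxE !eqxx ?[i1 == i0]eq_sym (negPf i01) /=.
    rewrite mulr0 add0r mulr1; apply: line_stalkN.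
    by apply: line_stalk_cast (line_stalkM (line_stalkM ws (aS i1 j0)) aV) _; ring.
  by rewrite mulr0 subr0 mulr1.
apply/rowP; apply: (ord2_neqW j01); rewrite (mul_entries _ _ i01) eE
    !mxE !eqxx ?[i1 == i0]eq_sym (negPf i01) ?(negPf j01) /=.
  by rewrite !mulr0 !mulr1 sub0r subr0 mulNr (divfK a_nz) addNr.
have -> : c 0 0 = w * ((-1) ^+ (i0 != j0) * ((-1) ^+ (i0 != j0) * tofrac (\det A))).
  by rewrite cE signrMK.
rewrite -D_eq /v !mulr0 !mulr1 sub0r subr0.
exact: (solve_pivot _ _ _ _ _ a_nz h_nz).
Qed.

(** The second row of [C = adj(A) T] when the columns of [A] are trivialised by [h] and [P]. The
    factor [h * P] appears because [T] is formed with the original determinant, not the trivialised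
    one. *)
Lemma cramer_second (F : fieldType) (a b c e h P x y : F) :
  a * e - b * c != 0 -> h != 0 -> P != 0 ->
  h * P * ((c / h * x + e / P * y) / (a * e - b * c)) * (a / h)
  + - (h * P * ((a / h * x + b / P * y) / (a * e - b * c))) * (c / h) = y.
Proof. by move=> D0 h0 P0; field; rewrite h0 P0 D0. Qed.

Lemma cancel_sections (V : zmodType) (u v u' v' : V) :
  u' + v' = (u + v) - (u - u') - (v - v').
Proof.
by rewrite -addrA -opprD addrACA [- (_ + _)]opprD addrA subrr sub0r opprD !opprK.
Qed.

(** The target twists [2 - d] and [0] are non-positive because [d > 1], so a power of a linear form
    trivialises them near [x]. *)
Lemma twist_form x j : x != 0 ->
  exists m (h : {mpoly k[3]}),
    [/\ h \is m.-homog, val_at h x != 0 & m%:Z = - tgt_twist d j].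
Proof.
move=> x0; rewrite /tgt_twist; have [_|_] := eqVneq j 0; last first.
  by exists 0%N, 1; split; rewrite ?dhomog1 ?/val_at ?meval1 ?oner_eq0 ?oppr0.
have [h h1 hx] := form_coord_neq0 x0; exists (d - 2)%N, (h ^+ (d - 2)); split.
- by rewrite -[X in X.-homog]mul1n; apply: dhomogMn.
- by rewrite val_atXn expf_neq0.
- by lia.
Qed.

(** The rank is one: an entry that does not vanish at [x] remains a unit on the open set where its
    product with [h] is non-zero, and the same section works throughout that set. *)
Lemma coker_locally_free_of_entries :
  (forall x, x != 0 -> val_at (\det A) x = 0 ->
    exists i j, val_at (A i j) x != 0) ->
  coker_locally_free d (\det A) (src_twist d) (tgt_twist d) A.
Proof.
move=> entry_neq0 x x0 Dx; have [i0 [j0 Ax]] := entry_neq0 x x0 Dx.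
have i01 := neq_lift i0 (0 : 'I_1); have j01 := neq_lift j0 (0 : 'I_1).
set i1 := lift i0 0 in i01; set j1 := lift j0 0 in j01.
have [m [h [hm hx me]]] := twist_form j1 x0.
have [n An _] := in_X_entry i0 j0.
exists 1%N, ((tofrac h)^-1 *: delta_mx 0 j1), (n + m)%N, (A i0 j0 * h); split.
- exact: dhomogM.
- by rewrite val_atM mulf_neq0.
- move=> y y0; rewrite val_atM mulf_eq0 negb_or => /andP[_ hy] i j.
  rewrite !mxE [i]ord1 eqxx /=; have [->|_] := eqVneq j j1.
    by rewrite mulr1; apply: line_stalk_cast (line_stalkV hm hy) _; rewrite me opprK.
  by rewrite mulr0; apply: line_stalk0.
- move=> y y0; rewrite val_atM mulf_eq0 negb_or => /andP[Ay hy] _.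
  exact: stalk_basis_of_entry i01 j01 y0 Ay hm hy me.
Qed.

Lemma not_coker_locally_free x : x != 0 ->
  (forall i j, val_at (A i j) x = 0) ->
  ~ coker_locally_free d (\det A) (src_twist d) (tgt_twist d) A.
Proof.
move=> x0 A_x free.
have Dx : val_at (\det A) x = 0.
  by rewrite det_mx22 -mulNr val_atD !val_atM !A_x !mulr0 addr0.
have [r [e [n [g [_ gx eS basis]]]]] := free x x0 Dx.
have [surj inj] := basis x x0 gx Dx.
have [h h1 hx] := form_coord_neq0 x0.
have h_nz : tofrac h != 0 by apply: val_at_neq0 hx.
have D_nz : tofrac (\det A) != 0 by rewrite tofrac_eq0; case: AX.
have HS m : line_stalk m%:Z x (tofrac h ^+ m).
  rewrite -tofracXn; apply: line_stalk_form.
  by rewrite -[X in X.-homog]mul1n; apply: dhomogMn.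
have HV m : line_stalk (- m%:Z) x (tofrac h ^- m).
  rewrite -tofracXn; apply: line_stalkV; last by rewrite val_atXn expf_neq0.
  by rewrite -[X in X.-homog]mul1n; apply: dhomogMn.
pose a i j := tofrac (A i j).
have aS i : line_stalk 1 x (a i 0).
  by apply: line_stalk_cast (entry_stalk x i 0) _; rewrite /tgt_twist /src_twist /=; ring.
have aS1 i : line_stalk d.-1%:Z x (a i 1).
  by apply: line_stalk_cast (entry_stalk x i 1) _; rewrite /tgt_twist /src_twist /=; lia.
have am i j : local_max x (a i j) by apply: local_max_form.
have b0m i : local_max x (a i 0 / tofrac h).
  by rewrite mulrC; apply: local_maxMl (HV 1%N) (am i 0).
(* [t0] and [t1] generate the stalk of the target. Lifting them yields the rows [c0], [c1] of [C]
   and [s0], [s1] of [S]. *)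
pose t0 : 'rV[{fraction {mpoly k[3]}}]_2 := tofrac h ^- (d - 2) *: delta_mx 0 0.
pose t1 : 'rV[{fraction {mpoly k[3]}}]_2 := delta_mx 0 1.
have [|c0 c0S [s0 s0S e0]] := surj t0.
  apply: (@ord2_neqW 0 1) => //; rewrite !mxE !eqxx /= ?mulr0 ?mulr1.
    by apply: line_stalk_cast (HV _) _; rewrite /tgt_twist /=; lia.
  exact: line_stalk0.
have [|c1 c1S [s1 s1S e1]] := surj t1.
  apply: (@ord2_neqW 0 1) => //; rewrite !mxE !eqxx /=.
    exact: line_stalk0.
  rewrite -[X in line_stalk _ _ X]tofrac1.
  exact: line_stalk_form (dhomog1 _ _).
(* [b0 i] and [b1 i] form row [i] of the trivialised [A]: the image of source generator [i], scaled
   by [h ^- d.-1], is [b0 i *: t0 + b1 i *: t1]. *)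
pose b0 i := a i 0 / tofrac h.
pose b1 i := a i 1 / tofrac h ^+ d.-1.
have HV1 : line_stalk (- 1) x (tofrac h)^-1 by exact: (HV 1%N).
have b0S i : line_stalk 0 x (b0 i) by apply: line_stalkM (aS i) HV1.
have b1S i : line_stalk 0 x (b1 i).
  by apply: line_stalk_cast (line_stalkM (aS1 i) (HV d.-1)) _; rewrite subrr.
(* Entry [(i, l)] of [T]: row [i] of [A C] gives zero in the cokernel, so injectivity puts its
   entries in the ideal of the curve. *)
have tau i l : line_stalk (- d%:Z) x ((b0 i * c0 0 l + b1 i * c1 0 l) / tofrac (\det A)).
  pose c := b0 i *: c0 + b1 i *: c1.
  have cS : bundle_stalk (fun=> 0) x c.
    move=> l'; rewrite !mxE; apply: line_stalkD.
      exact: line_stalkM (b0S i) (c0S l').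
    exact: line_stalkM (b1S i) (c1S l').
  have [/(_ _ l) wD _] := inj c cS.
  have [|w wS] := wD; last by rewrite !mxE => ->; rewrite (mulfK D_nz).
  (* Row [i] of [1 - A S], written in the source twists; its image under [A] is row [i] of
     [A C e]. *)
  pose s := tofrac h ^- d.-1 *: delta_mx 0 i - b0 i *: s0 - b1 i *: s1.
  exists s.
    move=> j; rewrite !mxE eqxx /=.
    apply: line_stalkD; last first.
      apply: line_stalkN.
      by apply: line_stalk_cast (line_stalkM (b1S i) (s1S j)) _; rewrite add0r.
    apply: line_stalkD; last first.
      apply: line_stalkN.
      by apply: line_stalk_cast (line_stalkM (b0S i) (s0S j)) _; rewrite add0r.
    have [_|_] := eqVneq j i; last by rewrite mulr0; apply: line_stalk0.
    by rewrite mulr1; apply: line_stalk_cast (HV d.-1) _; rewrite /src_twist; lia.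
  rewrite !mulmxBl -!scalemxAl -e0 -e1 mulmxDl -!scalemxAl !scalerBr -rowE.
  have -> : tofrac h ^- d.-1 *: row i (map_mx (@tofrac _) A) = b0 i *: t0 + b1 i *: t1.
    apply/rowP; apply: (@ord2_neqW 0 1) => //; rewrite !mxE !eqxx /= ?mulr0 ?mulr1.
      rewrite addr0 /b0 -mulrA -invfM -exprS mulrC.
      by have -> : (d - 2).+1 = d.-1 by lia.
    by rewrite add0r mulrC.
  exact: cancel_sections.
(* The second row of [adj(A)] involves only the [z_i], whose vanishing at [x] puts [c1] in the
   maximal ideal; [h ^+ d] brings [T] to degree zero. *)
have c1m l : local_max x (c1 0 l).
  have := local_maxD (local_maxMl (line_stalkM (HS d) (tau 1 l)) (b0m 0))
    (local_maxMl (line_stalkN (line_stalkM (HS d) (tau 0 l))) (b0m 1)).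
  have D_nz' : a 0 0 * a 1 1 - a 0 1 * a 1 0 != 0.
    by rewrite /a -!tofracM -tofracB -det_mx22.
  have P_nz : tofrac h ^+ d.-1 != 0 by apply: expf_neq0 h_nz.
  have -> : tofrac h ^+ d = tofrac h * tofrac h ^+ d.-1.
    by rewrite -exprS prednK // ltnW.
  rewrite /b0 /b1 det_mx22 tofracB !tofracM -/(a _ _) -/(a _ _) -/(a _ _) -/(a _ _).
  by rewrite (cramer_second _ _ D_nz' h_nz P_nz).
(* The second coordinate of [t1 = c1 e + s1 A] reads 1. Its first term lies in the maximal ideal
   through [c1], its second through the [q_i]. *)
apply: (@local_max1 _ x).
have -> : 1 = (c1 *m e + s1 *m map_mx (@tofrac _) A) 0 1.
  by rewrite -e1 addrC subrK mxE !eqxx.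
rewrite mxE; apply: local_maxD.
  rewrite mxE; apply: local_max_sum => l.
  rewrite mulrC; have := eS x x0 gx l 1; rewrite mxE => elS.
  exact: local_maxMl elS (c1m l).
rewrite mxE; apply: local_max_sum => i; rewrite mxE.
exact: local_maxMl (s1S i) (am i 1).
Qed.
End Cokernel.

(** * Singular points of the curve and vanishing of the entries *)

Section Geometry.
Variables (k : fieldType) (d : nat).
Implicit Types (f : {mpoly k[3]}) (p x : 'rV[k]_3) (A : 'M[{mpoly k[3]}]_2).

Lemma linear_form_eq0 f :
  f \is 1.-homog -> (forall l, f@_U_(l) = 0) -> f = 0.
Proof.
by move=> f1 f0; rewrite (linear_formE f1) big1 // => l _; rewrite f0 scale0r.
Qed.

Lemma val_at_linear f x :
  f \is 1.-homog -> val_at f x = \sum_l x 0 l * f@_U_(l).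
Proof.
move=> /linear_formE {1}->; rewrite /val_at raddf_sum; apply: eq_bigr => l _.
by rewrite /= mevalZ mevalXU mulrC.
Qed.

Lemma is_sing_entries A f p : in_X d A -> nu_is A f p ->
  is_sing f p <-> forall i j, val_at (A i j) p = 0.
Proof.
case=> A0 A1 free _ [[c c0 ->] Ap].
have derE l : val_at (mderiv l (c *: \det A)) p
    = c * ((A 0 0)@_U_(l) * val_at (A 1 1) p - (A 1 0)@_U_(l) * val_at (A 0 1) p).
  rewrite mderivZ {1}/val_at mevalZ det_mx22 mderivB !mderivM !(mderiv_linear _ (A0 _)).
  rewrite mevalB !mevalD !mevalM !mevalC.
  rewrite -[(A 0 0).@[_]]/(val_at _ _) -[(A 1 0).@[_]]/(val_at _ _) !Ap.
  by rewrite mul0r addr0 mulr0 add0r [X in _ - X]mulrC.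
have valE : val_at (c *: \det A) p = 0.
  rewrite /val_at mevalZ det_mx22 mevalB !mevalM.
  rewrite -[(A 0 0).@[_]]/(val_at _ _) -[(A 1 0).@[_]]/(val_at _ _).
  by rewrite !Ap mul0r mulr0 subrr mulr0.
split=> [[_ der0]|A_p]; last by split=> // l; rewrite derE !A_p !mulr0 subrr mulr0.
(* A vanishing gradient is a linear relation between [z_1] and [z_2] with coefficients [q_2(p)] and
   [- q_1(p)], which independence forces to be zero. *)
have [] := free (val_at (A 1 1) p) (- val_at (A 0 1) p).
  apply: linear_form_eq0 => [|l]; first by apply: dhomogD; apply: dhomogZ; apply: A0.
  move: (der0 l); rewrite derE => /eqP; rewrite mulf_eq0 (negPf c0) /= => /eqP e.
  by rewrite mcoeffD !mcoeffZ mulNr mulrC [X in _ - X]mulrC.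
move=> q1 /eqP; rewrite oppr_eq0 => /eqP q0 i.
apply: (@ord2_neqW 0 1) => //; move: i; exact: (@ord2_neqW 0 1).
Qed.

(** The coefficient matrix of two independent linear forms in three variables has rank 2, so its
    kernel is a line, spanned by [p]. *)
Lemma common_zero_unique A p x : in_X d A -> p != 0 ->
  (forall i, val_at (A i 0) p = 0) -> (forall i, val_at (A i 0) x = 0) ->
  exists c, x = c *: p.
Proof.
case=> A0 _ free _ p0 Ap Ax.
pose Z : 'M[k]_(3, 2) := \matrix_(l, i) (A i 0)@_U_(l).
have ker y : (forall i, val_at (A i 0) y = 0) -> (y <= kermx Z)%MS.
  move=> Ay; apply/sub_kermxP/rowP => i; rewrite !mxE -[RHS](Ay i).
  by rewrite (val_at_linear _ (A0 i)); apply: eq_bigr => l _; rewrite mxE.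
have rZ : \rank Z = 2%N.
  rewrite -mxrank_tr; apply/eqP; apply: inj_row_free => v vZ.
  have [] := free (v 0 0) (v 0 1).
    apply: linear_form_eq0 => [|l]; first by apply: dhomogD; apply: dhomogZ; apply: A0.
    have := congr1 (fun w : 'rV_3 => w 0 l) vZ.
    by rewrite /= mxE (@sum2_neq _ _ 0 1) // !mxE mcoeffD !mcoeffZ.
  by move=> v0 v1; apply/rowP; apply: (@ord2_neqW 0 1); rewrite ?mxE.
have pK : (p == kermx Z)%MS.
  by rewrite -(mxrank_leqif_eq (ker p Ap)) mxrank_ker rZ rank_rV p0.
by apply/sub_rVP; apply: submx_trans (ker x Ax) _; case/andP: pK.
Qed.

(** If all entries vanished at [x], then [x] would be a non-zero multiple of [p]; by homogeneity the
    [q_i] would vanish at [p] too, making [p] singular. *)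
Lemma entry_neq0 A f p x : in_X d A -> nu_is A f p -> p != 0 ->
  ~ is_sing f p -> x != 0 -> exists i j, val_at (A i j) x != 0.
Proof.
move=> AX Anu p0 nsing x0; case: (AX) => A0 A1 _ _.
have [/existsP[i /existsP[j Aij]]|] := boolP [exists i, exists j, val_at (A i j) x != 0].
  by exists i, j.
rewrite negb_exists => /forallP Ax; case: nsing.
have {}Ax i j : val_at (A i j) x = 0.
  by move: (Ax i); rewrite negb_exists => /forallP/(_ j); rewrite negbK => /eqP.
apply/(is_sing_entries AX Anu) => i.
have [c xE] := common_zero_unique AX p0 Anu.2 (Ax ^~ 0).
have c0 : c != 0 by apply: contra_neq x0 => c0; rewrite xE c0 scale0r.
apply: (@ord2_neqW 0 1) => //; first exact: Anu.2.
have /eqP := Ax i 1; rewrite xE (val_atZ_homog _ _ (A1 i)) mulf_eq0.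
by rewrite expf_eq0 (negPf c0) andbF => /eqP.
Qed.

(** Both sides are compared with the vanishing of all entries at [p]. That condition is decidable,
    which handles the negation in [singular_coker]. *)
Lemma singular_coker_sing A f p : (1 < d)%N -> in_X d A -> nu_is A f p ->
  p != 0 -> singular_coker d A <-> is_sing f p.
Proof.
move=> d1 AX Anu p0; have singE := is_sing_entries AX Anu.
split=> [sing|/singE]; last exact: not_coker_locally_free.
have [/forallP Ap|Ap] := boolP [forall i, forall j, val_at (A i j) p == 0].
  by apply/singE => i j; apply/eqP; apply: (forallP (Ap i)).
case: sing; apply: coker_locally_free_of_entries => // x x0 _.
apply: entry_neq0 AX Anu p0 _ x0 => /singE A_p.
by case/negP: Ap; apply/forallP => i; apply/forallP => j; rewrite A_p.
Qed.

(** * The homogeneous ideal of a point and surjectivity of [nu] *)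

Definition point_form p (c i : 'I_3) : {mpoly k[3]} := p 0 c *: 'X_i - p 0 i *: 'X_c.

(* The forms of degree n + 1 congruent to a multiple of X_c ^ (n + 1) modulo
   the ideal of the point p. *)
Definition point_reducible p c n f := exists (G : 'I_3 -> {mpoly k[3]}) (a : k),
  (forall i, G i \is n.-homog) /\
  f = \sum_i G i * point_form p c i + a *: 'X_c ^+ n.+1.

Lemma point_form_homog p c i : point_form p c i \is 1.-homog.
Proof.
by apply: dhomogD; rewrite ?dhomogN; apply: dhomogZ; rewrite dhomogX /= mdeg1.
Qed.

(** The [point_form p c i] are minors of the matrix with rows [p] and [X]; modulo them each
    coordinate is a multiple of ['X_c], which drives the reduction below. *)
Lemma coordE p c i : p 0 c != 0 ->
  'X_i = (p 0 c)^-1 *: point_form p c i + (p 0 i / p 0 c) *: 'X_c.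
Proof.
by move=> pc; rewrite scalerBr !scalerA mulVf // scale1r mulrC subrK.
Qed.

Lemma point_reducibleZ p c n f b :
  point_reducible p c n f -> point_reducible p c n (b *: f).
Proof.
case=> G [a [Gn ->]]; exists (fun i => b *: G i), (b * a); split.
  by move=> i; apply: dhomogZ.
rewrite scalerDr scalerA scaler_sumr; congr (_ + _).
by apply: eq_bigr => i _; rewrite scalerAl.
Qed.

Lemma point_reducibleD p c n f g :
  point_reducible p c n f -> point_reducible p c n g -> point_reducible p c n (f + g).
Proof.
case=> G [a [Gn ->]] [G' [a' [G'n ->]]].
exists (fun i => G i + G' i), (a + a'); split.
  by move=> i; apply: dhomogD.
rewrite addrACA scalerDl -big_split; congr (_ + _).
by apply: eq_bigr => i _; rewrite mulrDl.
Qed.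

Lemma point_reducible_form p c n i g : g \is n.-homog ->
  point_reducible p c n (g * point_form p c i).
Proof.
move=> gn; exists (fun j => if j == i then g else 0), 0; split.
  by move=> j; case: eqP => // _; apply: dhomog0.
rewrite scale0r addr0 (bigD1 i) //= eqxx big1 ?addr0 // => j /negPf ->.
by rewrite mul0r.
Qed.

Lemma point_reducible_pow p c n : point_reducible p c n ('X_c ^+ n.+1).
Proof.
exists (fun=> 0), 1; split; first by move=> i; apply: dhomog0.
by rewrite scale1r big1 ?add0r // => i _; rewrite mul0r.
Qed.

Lemma point_reducibleX p c n i f : p 0 c != 0 ->
  point_reducible p c n f -> point_reducible p c n.+1 ('X_i * f).
Proof.
move=> pc [G [a [Gn ->]]].
have Xhomog j m : 'X_j ^+ m \is [in k[3], m.-homog].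
  by rewrite -[X in X.-homog]mul1n; apply: dhomogMn; rewrite dhomogX /= mdeg1.
rewrite mulrDr -scalerAr; apply: point_reducibleD.
  exists (fun j => 'X_i * G j), 0; split.
    by move=> j; apply: (dhomogM (Xhomog i 1%N) (Gn j)).
  rewrite scale0r addr0 mulr_sumr; apply: eq_bigr => j _.
  by rewrite mulrA.
apply: point_reducibleZ; rewrite (coordE i pc) mulrDl -!scalerAl.
apply: point_reducibleD; apply: point_reducibleZ.
  by rewrite mulrC; apply: point_reducible_form.
by rewrite -exprS; apply: point_reducible_pow.
Qed.

Lemma point_reducible_monomial p c n (m : 'X_{1..3}) : p 0 c != 0 ->
  mdeg m = n.+1 -> point_reducible p c n 'X_[m].
Proof.
move=> pc; elim: n m => [|n IHn] m mE.
  have /mdeg1P[i /eqP ->] : mdeg m == 1%N by rewrite mE.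
  rewrite (coordE i pc); apply: point_reducibleD; apply: point_reducibleZ.
    rewrite -[X in point_reducible _ _ _ X]mul1r.
    by apply: point_reducible_form; apply: dhomog1.
  exact: (point_reducible_pow p c 0).
have /existsP[i mi] : [exists i, m i != 0%N].
  rewrite -negb_forall; apply: contra_eqN mE => /forallP m0.
  by rewrite mdegE big1 // => i _; apply/eqP.
rewrite -lep1mP in mi; rewrite -(submK mi) addmC mpolyXD.
apply: point_reducibleX pc (IHn _ _).
by apply/eqP; rewrite -eqSS -mE -{2}(submK mi) mdegD mdeg1 addn1.
Qed.

(** Evaluation at [p] kills the ideal part of the reduced expression and leaves [a] times a power of
    [p 0 c], hence [a = 0]. *)
Lemma vanishing_form p c n f : p 0 c != 0 -> f \is n.+1.-homog ->
  val_at f p = 0 -> exists2 G : 'I_3 -> {mpoly k[3]},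
    forall i, G i \is n.-homog & f = \sum_i G i * point_form p c i.
Proof.
move=> pc fn fp.
have [G [a [Gn fE]]] : point_reducible p c n f.
  rewrite [f]mpolyE big_seq; elim/big_rec: _ => [|m g mf IH].
    rewrite -[X in point_reducible _ _ _ X](scale0r ('X_c ^+ n.+1)).
    by apply: point_reducibleZ; apply: point_reducible_pow.
  apply: point_reducibleD IH; apply: point_reducibleZ.
  apply: point_reducible_monomial => //; exact: (dhomog_mf fn mf).
exists G => //; rewrite fE; suff -> : a = 0 by rewrite scale0r addr0.
move: fp; rewrite {1}fE val_atD.
rewrite {1}/val_at raddf_sum big1 => [|i _]; last first.
  by rewrite /= mevalM mevalB !mevalZ !mevalXU [X in _ - X]mulrC subrr mulr0.
rewrite add0r /val_at mevalZ rmorphXn /= mevalXU => /eqP.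
by rewrite mulf_eq0 expf_eq0 (negPf pc) /= orbF => /eqP.
Qed.

Lemma nu_surjective f p : (0 < d)%N -> in_M d f p ->
  exists2 A : 'M[{mpoly k[3]}]_2, in_X d A & nu_is A f p.
Proof.
move=> d0 [f0 fd p0 fp]; case/rV0Pn: (p0) => c pc.
have [|G Gd fE] := vanishing_form pc _ fp (n := d.-1); first by rewrite prednK.
(* The term of index [c] in [fE] is zero, so only the two other indices [a] and [b] contribute. *)
pose a := lift c (0 : 'I_2); pose b := lift c (1 : 'I_2).
have ac : (c == a) = false by apply: negPf; apply: neq_lift.
have bc : (c == b) = false by apply: negPf; apply: neq_lift.
have ab : (a == b) = false by rewrite (inj_eq lift_inj).
(* The sign on [G b] turns the determinant into the two-term sum that equals [f]. *)
pose A : 'M[{mpoly k[3]}]_2 := \matrix_(i, j)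
  if i == 0 then (if j == 0 then point_form p c a else - G b)
  else if j == 0 then point_form p c b else G a.
have pcc : point_form p c c = 0 by rewrite /point_form subrr.
have detA : \det A = f.
  rewrite det_mx22 !mxE /= fE (bigD1_ord c) //= !big_ord_recl big_ord0 addr0.
  rewrite pcc mulr0 add0r -/a mulrC mulNr opprK.
  by congr (_ + G _ * point_form p c _); apply: val_inj.
have A0 i : A i 0 = point_form p c (if i == 0 then a else b).
  by rewrite mxE /=; case: ifP.
exists A.
  split=> [i|i|u v e|]; last by rewrite detA.
  - by rewrite A0; apply: point_form_homog.
  - by rewrite mxE /=; case: ifP => _; rewrite ?dhomogN; apply: Gd.
  (* Comparing coefficients of ['X_a] and ['X_b] isolates [u * p 0 c] and [v * p 0 c]. *)
  have coef l : u * (point_form p c a)@_U_(l) + v * (point_form p c b)@_U_(l) = 0.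
    by have := congr1 (mcoeff U_(l)) e; rewrite mcoeffD !mcoeffZ !A0 mcoeff0.
  move: (coef a) (coef b).
  rewrite !mcoeffB !mcoeffZ !mcoeffXU !eqxx ac bc ab [b == a]eq_sym ab.
  rewrite !mulr0 !subr0 !mulr1 !mulr0 addr0 add0r => /eqP + /eqP.
  by rewrite !mulf_eq0 (negPf pc) !orbF => /eqP -> /eqP ->.
split; first by exists 1; rewrite ?oner_eq0 // detA scale1r.
by move=> i; rewrite A0 /val_at mevalB !mevalZ !mevalXU mulrC subrr.
Qed.

End Geometry.

Theorem lemma4p1 (k : closedFieldType) (k_char0 : [pchar k] =i pred0)
    (d : nat) (d_ge3 : (3 <= d)%N) :
  (forall (f : {mpoly k[3]}) (p : 'rV[k]_3), in_M d f p ->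
     forall A : 'M[{mpoly k[3]}]_2, in_X d A -> nu_is A f p ->
       (singular_coker d A <-> is_sing f p))
  /\
  (forall (f : {mpoly k[3]}) (p : 'rV[k]_3),
     in_M' d f p <-> in_universal_sing d f p).
Proof.
have d_gt1 : (1 < d)%N by apply: ltnW.
split=> [f p [_ _ p0 _] A AX Anu|f p]; first exact: singular_coker_sing.
split=> [[fpM [A [AX Anu sing]]]|[fpM sing]].
  split=> //; apply/(singular_coker_sing d_gt1 AX Anu) => //.
  by case: fpM.
(* [in_M'] asks for a matrix over the given point of [M]; surjectivity of [nu] provides one. *)
split=> //; have [A AX Anu] := nu_surjective (ltnW d_gt1) fpM.
exists A; split=> //; apply/(singular_coker_sing d_gt1 AX Anu) => //.
by case: fpM.
Qed.
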